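(* Let $n \ge 1$ and let $\alpha \in \mathbb{R}^n$ be a vector with non-negative entries such that $\sum_{i=1}^n \alpha_i = n$. Let $\mathrm{Mat}_n(\alpha)$ be the set of all $n \times n$ real matrices $A$ with non-negative entries such that the row sums of $A$ are all equal to $1$ and the column sums of $A$ are equal to $\alpha_1,\ldots,\alpha_n$. The following are equivalent. (1) The permanent of every matrix in $\mathrm{Mat}_n(\alpha)$ is strictly positive. (2) $\|\mathbf{1} - \alpha\|_1 < 2$. (3) $\sum_{i \in F} \alpha_i > |F| - 1$ for all $F \subseteq [n]$.
   Context: $\mathbf{1}$ denotes the all-ones vector in $\mathbb{R}^n$, $\|v\|_1 = \sum_i |v_i|$, and $[n]=\{1,\ldots,n\}$. *)

(* Defs.v *)
From mathcomp Require Import all_boot all_order all_algebra perm.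
From mathcomp Require Import classical_sets reals.

Set Implicit Arguments.
Unset Strict Implicit.
Unset Printing Implicit Defensive.

Import Order.TTheory GRing.Theory Num.Theory.
Local Open Scope ring_scope.
Local Open Scope classical_set_scope.

Definition permanent (R : realType) (n : nat) (A : 'M[R]_n) : R :=
  \sum_(s : 'S_n) \prod_(i < n) A i (s i).

Definition l1norm (R : realType) (n : nat) (v : 'rV[R]_n) : R :=
  \sum_(i < n) `|v 0 i|.

Definition Mat (R : realType) (n : nat) (alpha : 'rV[R]_n) : set 'M[R]_n :=
  [set A : 'M[R]_n | [/\ forall i j : 'I_n, 0 <= A i j,
                        forall i : 'I_n, \sum_(j < n) A i j = 1 &
                        forall j : 'I_n, \sum_(i < n) A i j = alpha 0 j]].

(* Main.v *)
(** If the permanent of a non-negative matrix vanishes, Hall's theorem yields a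
    set [F] of columns supported on fewer than [#|F|] rows; row sums being 1,
    these columns have total mass at most [#|F| - 1], against (3). Conversely, if
    (2) fails, then [F := {j | alpha j < 1}] has mass at most [#|F| - 1], so its
    columns can be supported on [#|F| - 1] rows, which forces a zero permanent. *)
Require Import Defs.
From mathcomp Require Import all_boot all_order all_algebra perm.
From mathcomp Require Import classical_sets reals.
From mathcomp Require Import ring lra zify.

Set Implicit Arguments.
Unset Strict Implicit.
Unset Printing Implicit Defensive.

Import Order.TTheory GRing.Theory Num.Theory.
Local Open Scope ring_scope.

Definition hall_condition (I J : finType) (N : I -> {set J}) :=
  [forall F : {set I}, (#|F| <= #|\bigcup_(i in F) N i|)%N].

(** A set violating the condition after the removal must contain [i], since the other neighbourhoods
    are unchanged. Taking [i] out of it lowers its size by one, so the strict inequality becomes a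
    weak one. *)
Lemma hall_condition_remove (I J : finType) (N : I -> {set J}) (i : I) (x : J) :
  hall_condition N ->
  ~~ hall_condition (fun k => if k == i then N i :\ x else N k) ->
  exists2 F : {set I}, i \notin F &
    (#|(\bigcup_(k in F) N k) :|: (N i :\ x)| <= #|F|)%N.
Proof.
move=> /forallP hN; rewrite negb_forall => /existsP[F]; rewrite -ltnNge => hF.
have [iF|iF] := boolP (i \in F); last first.
  suff E : \bigcup_(k in F) (if k == i then N i :\ x else N k) =
           \bigcup_(k in F) N k by rewrite E ltnNge hN in hF.
  by apply: eq_bigr => k kF; case: eqP => // ki; rewrite ki (negPf iF) in kF.
exists (F :\ i); first by rewrite !inE eqxx.
move: hF; rewrite (cardsD1 i F) iF ltnS; congr (_ <= _)%N; congr #|pred_of_set _|.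
rewrite (finset.big_setD1 i) //= eqxx finset.setUC; congr (_ :|: _).
by apply: eq_bigr => k; rewrite !inE => /andP[/negPf ->].
Qed.

(* Rado's argument: if some [N i] has two elements [x] and [y], submodularity of
   [F |-> #|\bigcup_(i in F) N i|] shows that one of them can be removed while
   preserving Hall's condition; at the end all the [N i] are singletons. *)
Theorem hall_marriage (I J : finType) (N : I -> {set J}) :
  hall_condition N -> exists2 f : I -> J, injective f & forall i, f i \in N i.
Proof.
have [m] := ubnP (\sum_i #|N i|)%N.
elim: m N => // m IHm N; rewrite ltnS => le_m hN.
have [/existsP[i Ni]|] := boolP [exists i, (1 < #|N i|)%N].
  have [x [y [xN yN xy]]] := card_gt1P Ni.
  have remove z : z \in N i ->
      hall_condition (fun k => if k == i then N i :\ z else N k) ->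
      exists2 f : I -> J, injective f & forall i, f i \in N i.
    move=> zN /IHm[|f f_inj fN]; last first.
      exists f => // k; move: (fN k); case: eqP => // ->.
      by rewrite !inE => /andP[].
    apply: leq_trans le_m; rewrite (bigD1 i) //= eqxx [X in (_ < X)%N](bigD1 i) //=.
    rewrite [X in (_ < X + _)%N](cardsD1 z) zN add1n addSn ltnS leq_add2l.
    by apply: leq_sum => k /negPf ->.
  have [/(remove _ xN)//|/(hall_condition_remove hN)[F1 iF1 h1]] := boolP
    (hall_condition (fun k => if k == i then N i :\ x else N k)).
  have [/(remove _ yN)//|/(hall_condition_remove hN)[F2 iF2 h2]] := boolP
    (hall_condition (fun k => if k == i then N i :\ y else N k)).
  set P := _ :|: _ in h1; set Q := _ :|: _ in h2.
  (* As [x != y], [P :|: Q] contains all of [N i]; Hall's condition for [F1 :|: F2] enlarged by [i]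
     gives the extra one. *)
  have hU : (#|F1 :|: F2| < #|P :|: Q|)%N.
    have := forallP hN (i |: (F1 :|: F2)).
    rewrite cardsU1 !inE (negPf iF1) (negPf iF2) add1n => /leq_trans; apply.
    apply/subset_leq_card/finset.bigcupsP => k; rewrite !inE => /or3P[/eqP->|kF|kF].
    - apply/fintype.subsetP => z zN; rewrite !inE zN !andbT.
      by have [->|] := eqVneq z x; rewrite ?xy ?orbT.
    - apply: fintype.subset_trans (finset.subsetUl _ _); apply: fintype.subset_trans (finset.subsetUl _ _).
      exact: finset.bigcup_sup.
    - apply: fintype.subset_trans (finset.subsetUr _ _); apply: fintype.subset_trans (finset.subsetUl _ _).
      exact: finset.bigcup_sup.
  have hI : (#|F1 :&: F2| <= #|P :&: Q|)%N.
    apply: leq_trans (forallP hN _) _.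
    apply/subset_leq_card/finset.bigcupsP => k; rewrite inE => /andP[kF1 kF2].
    by rewrite finset.subsetI; apply/andP; split; apply: fintype.subset_trans (finset.subsetUl _ _);
      apply: finset.bigcup_sup.
  (* Adding [hU] and [hI] gives [#|F1| + #|F2| < #|P| + #|Q|], against [h1] and [h2]. *)
  have := cardsUI P Q; have := cardsUI F1 F2; lia.
rewrite negb_exists => /forallP card_le1.
have /fin_all_exists[f fN] i : exists x, N i = [set x].
  apply/cards1P; rewrite eqn_leq leqNgt card_le1 /=.
  by have := forallP hN [set i]; rewrite finset.big_set1 cards1.
exists f => [i j fij|i]; last by rewrite fN set11.
apply/eqP/negPn/negP => ij.
have := forallP hN [set i; j].
by rewrite cards2 ij finset.big_setU1 ?inE //= finset.big_set1 !fN fij finset.setUid cards1.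
Qed.

Section Permanent.

Variables (R : realType) (n : nat).
Implicit Types (A : 'M[R]_n) (E F : {set 'I_n}).

(** By counting, no permutation can draw all its entries in the columns [F] from the rows [E], so
    every product has a zero factor. *)
Lemma permanent_zero_block A E F :
  (#|E| < #|F|)%N -> (forall i j, i \notin E -> j \in F -> A i j = 0) ->
  permanent A = 0.
Proof.
move=> ltEF A0; apply: big1 => s _.
have : ~~ (s @^-1: F \subset E).
  apply/negP => /subset_leq_card; rewrite leqNgt => /negP; apply.
  by rewrite card_preimset //; apply: perm_inj.
case/fintype.subsetPn => i; rewrite inE => sF iE.
by rewrite (bigD1 i) //= A0 // mul0r.
Qed.

Lemma permanent_le0_block A :
  (forall i j, 0 <= A i j) -> permanent A <= 0 ->
  exists E F, (#|E| < #|F|)%N /\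
    (forall i j, i \notin E -> j \in F -> A i j = 0).
Proof.
move=> A_ge0 perm_le0.
pose N j := [set i | A i j != 0].
have [/hall_marriage[f f_inj fN]|] := boolP (hall_condition N).
  suff : 0 < permanent A by rewrite ltNge perm_le0.
  (* The matching sends columns to rows, whereas the permanent uses permutations from rows to
     columns. *)
  pose s := (perm f_inj)^-1%g.
  rewrite /permanent (bigD1 s) //= ltr_wpDr //.
    by apply: sumr_ge0 => t _; apply: prodr_ge0.
  apply: prodr_gt0 => i _; rewrite lt0r A_ge0 andbT.
  have := fN (s i); rewrite inE.
  by rewrite -[f (s i)](permE f_inj) permKV.
rewrite negb_forall => /existsP[F]; rewrite -ltnNge => ltF.
exists (\bigcup_(j in F) N j), F; split=> // i j iE jF.
apply/eqP/negPn/negP => Aij; case/negP: iE.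
by apply/finset.bigcupP; exists j; rewrite ?inE.
Qed.

Variable alpha : 'rV[R]_n.
Hypothesis alpha_ge0 : forall j, 0 <= alpha 0 j.
Hypothesis alpha_sum : \sum_j alpha 0 j = n%:R.

(** All the mass of the columns [F] lies in the rows [E], each of which carries at most 1. *)
Lemma Mat_zero_block_sum A E F :
  Mat alpha A -> (forall i j, i \notin E -> j \in F -> A i j = 0) ->
  \sum_(j in F) alpha 0 j <= #|E|%:R.
Proof.
case=> A_ge0 rowA colA A0.
under eq_bigr => j _ do rewrite -colA.
rewrite exchange_big /= (bigID (mem E)) /= [X in _ + X]big1 ?addr0; last first.
  by move=> i iE; apply: big1 => j; apply: A0.
rewrite -sumr_const; apply: ler_sum => i _.
by rewrite -(rowA i) [leRHS](bigID (mem F)) /= lerDl sumr_ge0.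
Qed.

Lemma Mat_zero_block_exists E F :
  \sum_(j in F) alpha 0 j <= #|E|%:R -> (#|E| < n)%N ->
  exists2 A, Mat alpha A & forall i j, i \notin E -> j \in F -> A i j = 0.
Proof.
set a := \sum_(j in F) alpha 0 j; set e : R := #|E|%:R => le_ae ltEn.
have lt_en : e < n%:R by rewrite ltr_nat.
have na_gt0 : 0 < n%:R - a by lra.
have a_ge0 : 0 <= a by apply: sumr_ge0.
have e_ge0 : 0 <= e by [].
have sumFC : \sum_(j in ~: F) alpha 0 j = n%:R - a.
  rewrite -alpha_sum [in RHS](bigID (mem F)) /= -/a addrAC subrr add0r.
  by apply: eq_bigl => j; rewrite inE.
have ae1 : a / e <= 1.
  have [->|e0] := eqVneq e 0; first by rewrite invr0 mulr0.
  by rewrite ler_pdivrMr ?mul1r // lt0r e0.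
(* When [e = 0], also [a = 0], and the junk value [/ 0 = 0] is the right one. *)
have aeK j : j \in F -> e * (alpha 0 j / e) = alpha 0 j.
  move=> jF; have [e0|e0] := eqVneq e 0; last by rewrite mulrC divfK.
  have a0 : a = 0 by lra.
  have := psumr_eq0P (fun i _ => alpha_ge0 i) a0 jF => ->.
  by rewrite mul0r mulr0.
have aeK' : e * (a / e) = a.
  by rewrite /a mulr_suml mulr_sumr; apply: eq_bigr.
(* Each column in [F] is split evenly among the rows [E], which uses up [a / e] of each such row.
   Every row then spreads what remains of its unit mass over the columns outside [F], in proportion
   to [alpha]. *)
exists (\matrix_(i, j) if j \in F then (i \in E)%:R * (alpha 0 j / e)
          else (1 - (i \in E)%:R * (a / e)) * (alpha 0 j / (n%:R - a))); last first.
  by move=> i j /negPf iE jF; rewrite mxE jF iE mul0r.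
have sumE (c : R) : \sum_(i < n) (i \in E)%:R * c = e * c.
  rewrite -mulr_suml; congr (_ * _).
  by rewrite /e -sum1_card natr_sum [RHS]big_mkcond /=; apply: eq_bigr => i _; case: ifP.
split.
- move=> i j; rewrite mxE; case: ifP => _.
    by rewrite mulr_ge0 // divr_ge0.
  apply: mulr_ge0; last by rewrite divr_ge0 // ltW.
  rewrite subr_ge0.
  by case: (i \in E); rewrite ?mul1r ?mul0r.
- move=> i; under eq_bigr => j _ do rewrite mxE.
  rewrite (bigID (mem F)) /=.
  under eq_bigr => j -> do [].
  rewrite -mulr_sumr -mulr_suml -/a.
  under [X in _ + X]eq_bigr => j /negPf -> do [].
  rewrite -mulr_sumr -mulr_suml.
  have -> : \sum_(j | j \notin F) alpha 0 j = n%:R - a.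
    by rewrite -sumFC; apply: eq_bigl => j; rewrite inE.
  by rewrite divff ?gt_eqF // mulr1 addrC subrK.
- move=> j; under eq_bigr => i _ do rewrite mxE.
  case: (boolP (j \in F)) => jF /=; first by rewrite sumE aeK.
  rewrite -mulr_suml sumrB sumE aeK' sumr_const card_ord.
  by rewrite mulrC divfK // gt_eqF.
Qed.

Lemma sum_one_sub F :
  \sum_(j in F) (1 - alpha 0 j) = #|F|%:R - \sum_(j in F) alpha 0 j.
Proof. by rewrite sumrB sumr_const. Qed.

Lemma sum_one_sub0 : \sum_j (1 - alpha 0 j) = 0.
Proof. by rewrite sumrB alpha_sum sumr_const card_ord subrr. Qed.

Lemma l1norm_sub_alpha :
  let F := [set j | alpha 0 j < 1] in
  l1norm (const_mx 1 - alpha) = 2 * (#|F|%:R - \sum_(j in F) alpha 0 j).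
Proof.
move=> F.
rewrite -sum_one_sub.
(* Adding the zero sum of the [1 - alpha 0 j] turns each absolute value into twice a positive part,
   and [F] is where that part is nonzero. *)
rewrite -[LHS]addr0 -[X in _ + X]sum_one_sub0 /l1norm -big_split /= mulr_sumr.
rewrite [RHS]big_mkcond /=; apply: eq_bigr => j _; rewrite !mxE inE.
case: ltP => h; first by rewrite gtr0_norm ?subr_gt0 //; ring.
by rewrite ler0_norm ?subr_le0 //; ring.
Qed.

(** With [x = 1 - alpha 0 j], the quantity [|x| + x] is at least [2 * x] for [j] in [F] and at least
    0 elsewhere. *)
Lemma sum_le_l1norm_sub_alpha F :
  2 * (#|F|%:R - \sum_(j in F) alpha 0 j) <= l1norm (const_mx 1 - alpha).
Proof.
rewrite -sum_one_sub.
rewrite -[leRHS]addr0 -[X in _ + X]sum_one_sub0 /l1norm -big_split /= mulr_sumr.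
rewrite [leLHS]big_mkcond /=; apply: ler_sum => j _; rewrite !mxE.
by have := ler_norm (1 - alpha 0 j); have := ler_norm (- (1 - alpha 0 j));
  rewrite normrN; case: ifP => _; lra.
Qed.

End Permanent.

Local Open Scope classical_set_scope.

Theorem theorem2p2 (R : realType) (n : nat) (hn : (1 <= n)%N)
    (alpha : 'rV[R]_n) (alpha_ge0 : forall i : 'I_n, 0 <= alpha 0 i)
    (alpha_sum : \sum_(i < n) alpha 0 i = n%:R) :
  [<-> forall A : 'M[R]_n, Mat alpha A -> 0 < permanent A;
       l1norm (const_mx 1 - alpha) < 2;
       forall F : {set 'I_n}, #|F|%:R - 1 < \sum_(i in F) alpha 0 i].
Proof.
split; last split.
- move=> perm_gt0; rewrite l1norm_sub_alpha // ltNge; apply/negP.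
  set F := [set j | alpha 0 j < 1]%SET => le2.
  have F_ge1 : #|F|%:R - 1 >= \sum_(j in F) alpha 0 j by lra.
  (* The mass of [F] is non-negative and at most [#|F| - 1], so [F] is nonempty. *)
  have /card_gt0P[j0 j0F] : (0 < #|F|)%N.
    rewrite -(ltr_nat R).
    have : 0 <= \sum_(j in F) alpha 0 j by apply: sumr_ge0.
    lra.
  (* The indices in [F :\ j0] are reused as row indices; only their number [#|F| - 1] matters. *)
  have cardF : #|F| = #|F :\ j0|.+1 by rewrite (cardsD1 j0) j0F.
  have [||A MA A0] := Mat_zero_block_exists (E := F :\ j0) (F := F) alpha_ge0 alpha_sum.
  + by apply: le_trans F_ge1 _; rewrite cardF -natr1 addrK.
  + by rewrite -cardF -[leqRHS]card_ord max_card.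
  + have := perm_gt0 A MA.
    by rewrite (permanent_zero_block _ A0) ?ltxx // cardF.
- move=> lt2 F; have := sum_le_l1norm_sub_alpha alpha_sum F; lra.
- move=> gtF A MA; rewrite ltNge; apply/negP => perm_le0.
  have [A_ge0 _ _] := MA.
  have [E [F [ltEF A0]]] := permanent_le0_block A_ge0 perm_le0.
  have := Mat_zero_block_sum MA A0.
  (* Integrality sharpens [#|E| < #|F|] to [#|E| <= #|F| - 1], which meets the strict bound
     [gtF]. *)
  have : #|E|.+1%:R <= #|F|%:R :> R by rewrite ler_nat.
  rewrite -natr1; have := gtF F; lra.
Qed.
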